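(* Let $k$ be a field, let $d$ be a natural number, let $\mathcal{D}$ be one of the categories $\mathcal{T}$, $\mathcal{RT}$, or $\mathcal{T}_l$ (for some integer $l\ge 2$), and let $M$ be a $d$-smallish $k$-linear $\mathcal{D}^{\mathrm{op}}$-module. Then there exists a polynomial $f_M(t)$ such that, for every object $T$ of $\mathcal{D}$, $\dim_k M(T)\le f_M(|T|)$, where $|T|$ is the number of edges of $T$.
   Context: A tree is a finite nonempty connected acyclic graph; $|T|$ is the number of edges of $T$; a leaf is a vertex of degree 1. A contraction $\varphi:T\to T'$ of trees is a map on vertex sets such that adjacent vertices of $T$ are sent to equal or adjacent vertices of $T'$, and the preimage of every vertex of $T'$ is the vertex set of a (nonempty, connected) subtree of $T$. Let $\mathcal{T}$ be the category of trees with contractions as morphisms. A rooted tree is a tree with a chosen vertex (the root); let $\mathcal{RT}$ be the category of rooted trees with contractions that send root to root. For an integer $l\ge 2$, let $\mathcal{T}_l\subset\mathcal{T}$ be the full subcategory of trees with at most $l$ leaves. For $\mathcal{D}\in\{\mathcal{T},\mathcal{RT},\mathcal{T}_l\}$, a ($k$-linear) $\mathcal{D}^{\mathrm{op}}$-module is a functor from $\mathcal{D}^{\mathrm{op}}$ to $k$-modules. For an object $S$ of $\mathcal{D}$, the principal projective $P_S$ is the $\mathcal{D}^{\mathrm{op}}$-module with $P_S(T)$ the free $k$-module on the set $\operatorname{Hom}_{\mathcal{D}}(T,S)$, with morphisms acting by composition. A $\mathcal{D}^{\mathrm{op}}$-module is generated in degrees $\le d$ if it is isomorphic to a quotient of a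 finite direct sum $\bigoplus_{i=1}^r P_{T_i}$ where each $T_i$ is an object of $\mathcal{D}$ with at most $d$ edges. It is $d$-small if it is isomorphic to a subquotient of a module generated in degrees $\le d$. It is $d$-smallish if it admits a (finite) filtration by submodules whose associated graded module is $d$-small. *)

(* Defs.v *)
From HB Require Import structures.
From mathcomp Require Import all_boot all_order all_algebra.

Set Implicit Arguments.
Unset Strict Implicit.
Unset Printing Implicit Defensive.

Import GRing.Theory.
Local Open Scope ring_scope.
Local Open Scope quotient_scope.

(* A closed walk without repeated vertices is a vertex or an edge traversed   *)
(* back and forth when it has size at most 2, and a cycle otherwise.          *)
Record tree := Tree {
  vertex :> finType;
  adj : rel vertex;
  adj_sym : symmetric adj;
  adj_irr : irreflexive adj;
  tree_nonempty : (0 < #|vertex|)%N;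
  tree_connected : forall x y, connect adj x y;
  tree_acyclic : forall c : seq vertex,
    cycle adj c -> uniq c -> (size c <= 2)%N
}.
Arguments adj {t}.

Definition edges (T : tree) : {set {set T}} :=
  [set [set p.1; p.2] | p : T * T & adj p.1 p.2].

Definition nb_edges (T : tree) : nat := #|edges T|.

Definition leaves (T : tree) : {set T} :=
  [set x | #|[set y | adj x y]| == 1%N].

Definition induced (T : tree) (A : {set T}) : rel T :=
  [rel x y | [&& adj x y, x \in A & y \in A]].

(* Subgraphs of a tree are acyclic, so that only nonemptiness and             *)
(* connectedness have to be required.                                         *)
Definition is_subtree (T : tree) (A : {set T}) : bool :=
  (A != set0) &&
  [forall x in A, forall y in A, connect (induced A) x y].

Definition is_contraction (S T : tree) (f : {ffun S -> T}) : bool :=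
  [forall x, forall y, adj x y ==> ((f x == f y) || adj (f x) (f y))] &&
  [forall v : T, is_subtree [set x | f x == v]].

Lemma is_subtreeP (T : tree) (A : {set T}) :
  reflect ((exists x, x \in A) /\
           {in A &, forall x y, connect (induced A) x y}) (is_subtree A).
Proof.
apply: (iffP andP) => -[A0 Ac]; split; first exact/set0Pn.
- by move=> x y xA yA; move/forall_inP: Ac => /(_ x xA) /forall_inP /(_ y yA).
- exact/set0Pn.
- by apply/forall_inP => x xA; apply/forall_inP => y yA; apply: Ac.
Qed.

Lemma is_contractionP (S T : tree) (f : {ffun S -> T}) :
  reflect ((forall x y, adj x y -> f x = f y \/ adj (f x) (f y)) /\
           (forall v, is_subtree [set x | f x == v])) (is_contraction f).
Proof.
apply: (iffP andP) => -[fa fc]; split.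
- move=> x y xy; move/forallP: fa => /(_ x) /forallP /(_ y) /implyP /(_ xy).
  by case/orP => [/eqP|]; [left|right].
- exact/forallP.
- apply/forallP => x; apply/forallP => y; apply/implyP => xy.
  by case: (fa x y xy) => [->|->]; rewrite ?eqxx ?orbT.
- exact/forallP.
Qed.

Lemma tree_bridge (T : tree) (u v : T) : adj u v ->
  ~~ connect [rel x y | adj x y && ~~ ((x == u) && (y == v))] u v.
Proof.
move=> uv; apply/negP => /connectP [p0 p0e].
case/shortenP: p0e => p pe up _ vE {p0}.
have pa : path adj u p by apply: sub_path pe => x y /= /andP[].
have cy : cycle adj (u :: p) by rewrite /= rcons_path pa -vE adj_sym.
have := tree_acyclic cy up.
case: p pe up vE {pa cy} => [|w [|//]] /=.
  by move=> _ _ vE; move: uv; rewrite vE adj_irr.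
by rewrite andbT => /andP[_ /negP nuv] _ vE; case: nuv; rewrite vE !eqxx.
Qed.

Lemma contraction_lift_edge (S T : tree) (f : {ffun S -> T}) (u v : T) :
  is_contraction f -> adj u v ->
  exists a b, [/\ adj a b, f a = u & f b = v].
Proof.
move=> /is_contractionP[fa fc] uv.
have /is_subtreeP[[x]] := fc u; rewrite inE => /eqP xu _.
have /is_subtreeP[[y]] := fc v; rewrite inE => /eqP yv _.
have [/existsP[a /existsP[b /and3P[ab /eqP au /eqP bv]]]|nE] :=
  boolP [exists a, exists b, [&& adj a b, f a == u & f b == v]].
  by exists a, b.
pose e := [rel x y : T | adj x y && ~~ ((x == u) && (y == v))].
case/negP: (tree_bridge uv); rewrite -/e -[X in connect _ X]xu -yv.
have step (a b : S) : adj a b -> connect e (f a) (f b).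
  move=> ab; case: (fa a b ab) => [->//|fab]; apply: connect1 => /=.
  rewrite fab /=; apply: contra nE => /andP[au bv].
  by apply/existsP; exists a; apply/existsP; exists b; rewrite ab au bv.
case/connectP: (tree_connected x y) => p pp ->.
clearbody e; elim: p x pp {xu} => [|w p IH] x //= /andP[xw wp].
exact: connect_trans (step _ _ xw) (IH _ wp).
Qed.

Lemma contraction_preim_subtree (S T : tree) (f : {ffun S -> T}) (A : {set T}) :
  is_contraction f -> is_subtree A -> is_subtree [set x | f x \in A].
Proof.
move=> fC /is_subtreeP[[w wA] Ac].
have [fa fc] := is_contractionP _ fC.
apply/is_subtreeP; split.
  have /is_subtreeP[[x]] := fc w; rewrite inE => /eqP xw _.
  by exists x; rewrite inE xw.
move=> x y; rewrite !inE => xA yA.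
have fib a b : f a \in A -> f a = f b ->
    connect (induced [set x | f x \in A]) a b.
  move=> aA ab; have /is_subtreeP[_ /(_ a b)] := fc (f a).
  rewrite !inE ab eqxx => /(_ isT isT); apply: connect_sub => c d.
  case/and3P=> cd; rewrite !inE => /eqP cb /eqP db; apply: connect1.
  by apply/and3P; split=> //; rewrite inE ?cb ?db -ab.
have /connectP[p pp yE] := Ac _ _ xA yA.
elim: p x xA pp yE => [|v p IH] x xA /=; first by move=> _ yE; apply: fib.
move=> /andP[/and3P[xv _ vA] vp] yE.
have [a [b [ab ax bv]]] := contraction_lift_edge fC xv.
apply: connect_trans (fib _ _ xA (esym ax)) _.
have bA : f b \in A by rewrite bv.
apply: (@connect_trans _ _ b).
  by apply/connect1/and3P; split=> //; rewrite inE ?ax.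
by apply: IH; rewrite ?bv.
Qed.

Lemma id_contraction (T : tree) : is_contraction [ffun x : T => x].
Proof.
apply/is_contractionP; split; first by move=> x y xy; right; rewrite !ffunE.
move=> v; apply/is_subtreeP; split; first by exists v; rewrite inE ffunE.
by move=> x y; rewrite !inE !ffunE => /eqP-> /eqP->.
Qed.

Lemma comp_contraction (R S T : tree) (g : {ffun S -> T}) (f : {ffun R -> S}) :
  is_contraction g -> is_contraction f ->
  is_contraction [ffun x => g (f x)].
Proof.
move=> gC fC; have [ga gc] := is_contractionP _ gC.
have [fa _] := is_contractionP _ fC.
apply/is_contractionP; split.
  move=> x y xy; rewrite !ffunE.
  by case: (fa x y xy) => [->|/ga//]; left.
move=> v; have := contraction_preim_subtree fC (gc v).
by congr is_subtree; apply/setP => x; rewrite !inE ffunE.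
Qed.

(* The field osize is extra data with no axiom; for the categories of trees   *)
(* it is the number of edges.                                                 *)
Record category := Category {
  obj :> Type;
  hom : obj -> obj -> finType;
  idm : forall X, hom X X;
  comp : forall X Y Z, hom Y Z -> hom X Y -> hom X Z;
  comp1m : forall X Y (f : hom X Y), comp (idm Y) f = f;
  compm1 : forall X Y (f : hom X Y), comp f (idm X) = f;
  compA : forall W X Y Z (h : hom Y Z) (g : hom X Y) (f : hom W X),
    comp h (comp g f) = comp (comp h g) f;
  osize : obj -> nat
}.
Arguments hom {c}.
Arguments idm {c}.
Arguments comp {c X Y Z}.
Arguments osize {c}.

Definition contraction (S T : tree) : finType :=
  {f : {ffun S -> T} | is_contraction f}.

Definition contraction_id (T : tree) : contraction T T :=
  exist (fun f => is_true (is_contraction f)) _ (id_contraction T).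

Definition contraction_comp (R S T : tree)
    (g : contraction S T) (f : contraction R S) : contraction R T :=
  exist (fun f => is_true (is_contraction f)) _
    (comp_contraction (valP g) (valP f)).

Lemma contraction_comp1m (S T : tree) (f : contraction S T) :
  contraction_comp (contraction_id T) f = f.
Proof. by apply/val_inj/ffunP => x; rewrite !ffunE. Qed.

Lemma contraction_compm1 (S T : tree) (f : contraction S T) :
  contraction_comp f (contraction_id S) = f.
Proof. by apply/val_inj/ffunP => x; rewrite !ffunE. Qed.

Lemma contraction_compA (Q R S T : tree)
    (h : contraction S T) (g : contraction R S) (f : contraction Q R) :
  contraction_comp h (contraction_comp g f) =
  contraction_comp (contraction_comp h g) f.
Proof. by apply/val_inj/ffunP => x; rewrite !ffunE. Qed.

Definition tree_cat : category :=
  @Category tree contraction contraction_id contraction_comp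
    contraction_comp1m contraction_compm1 contraction_compA nb_edges.

Record rooted_tree := RootedTree { rtree :> tree; root : rtree }.
Arguments root : clear implicits.

Definition rcontraction (S T : rooted_tree) : finType :=
  {f : contraction S T | val f (root S) == root T}.

Lemma rcontraction_id_subproof (T : rooted_tree) :
  val (contraction_id T) (root T) == root T.
Proof. by rewrite ffunE. Qed.

Definition rcontraction_id (T : rooted_tree) : rcontraction T T :=
  exist (fun f : contraction T T => is_true (val f (root T) == root T)) _
    (rcontraction_id_subproof T).

Lemma rcontraction_comp_subproof (R S T : rooted_tree)
    (g : rcontraction S T) (f : rcontraction R S) :
  val (contraction_comp (val g) (val f)) (root R) == root T.
Proof. by rewrite ffunE (eqP (valP f)) (eqP (valP g)). Qed.

Definition rcontraction_comp (R S T : rooted_tree)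
    (g : rcontraction S T) (f : rcontraction R S) : rcontraction R T :=
  exist (fun f : contraction R T => is_true (val f (root R) == root T)) _
    (rcontraction_comp_subproof g f).

Lemma rcontraction_comp1m (S T : rooted_tree) (f : rcontraction S T) :
  rcontraction_comp (rcontraction_id T) f = f.
Proof. exact/val_inj/contraction_comp1m. Qed.

Lemma rcontraction_compm1 (S T : rooted_tree) (f : rcontraction S T) :
  rcontraction_comp f (rcontraction_id S) = f.
Proof. exact/val_inj/contraction_compm1. Qed.

Lemma rcontraction_compA (Q R S T : rooted_tree)
    (h : rcontraction S T) (g : rcontraction R S) (f : rcontraction Q R) :
  rcontraction_comp h (rcontraction_comp g f) =
  rcontraction_comp (rcontraction_comp h g) f.
Proof. exact/val_inj/contraction_compA. Qed.

Definition rooted_tree_cat : category :=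
  @Category rooted_tree rcontraction rcontraction_id rcontraction_comp
    rcontraction_comp1m rcontraction_compm1 rcontraction_compA
    (fun T => nb_edges T).

Section FullSubcategory.
Variables (C : category) (P : pred C).

Definition full_obj := {X : C | P X}.

Definition full_subcat : category :=
  @Category full_obj (fun X Y => hom (sval X) (sval Y))
    (fun X => idm (sval X))
    (fun _ _ _ g f => comp g f)
    (fun _ _ f => comp1m f)
    (fun _ _ f => compm1 f)
    (fun _ _ _ _ h g f => compA h g f)
    (fun X => osize (sval X)).

End FullSubcategory.

Definition few_leaves_cat (l : nat) : category :=
  @full_subcat tree_cat (fun T : tree => #|leaves T| <= l)%N.

Section LmodSubQuotient.
Variables (k : fieldType) (V : lmodType k) (S : submodClosed V).

Definition lsub := {x : V | x \in S}.
HB.instance Definition _ := SubType.on lsub.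
HB.instance Definition _ := Choice.on lsub.
HB.instance Definition _ := [SubChoice_isSubLmodule of lsub by <:].

(* MathComp only equips V/S with its additive structure. *)
Fact submod_zmod_closed : zmod_closed S.
Proof.
split=> [|x y xS yS]; first exact: (rpred0 S).
by rewrite -scaleN1r; apply: (@rpredD _ S) => //; apply: (@rpredZ _ _ S).
Qed.

Definition submod_pred : {pred V} := S.
HB.instance Definition _ :=
  GRing.isZmodClosed.Build V submod_pred submod_zmod_closed.

Definition lquot := Quotient.quot submod_pred.
HB.instance Definition _ := EqQuotient.on lquot.
HB.instance Definition _ := GRing.Zmodule.on lquot.

Lemma lquot_eq (x y : V) : (\pi_lquot x = \pi_lquot y) <-> (x - y \in S).
Proof.
rewrite -[x - y \in S]/(x - y \in submod_pred) Quotient.idealrBE.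
by split=> [->|/eqP].
Qed.

Lemma lquotD (x y : V) : \pi_lquot (x + y) = \pi_lquot x + \pi_lquot y.
Proof. by rewrite !piE. Qed.

Lemma lquotW (P : lquot -> Prop) : (forall x, P (\pi_lquot x)) -> forall q, P q.
Proof. by move=> Ppi q; rewrite -[q](@reprK V lquot); apply: Ppi. Qed.

Definition lquot_scale (a : k) (q : lquot) : lquot := \pi_lquot (a *: repr q).

Lemma lquot_scale_pi a (x : V) :
  lquot_scale a (\pi_lquot x) = \pi_lquot (a *: x).
Proof.
apply/lquot_eq; rewrite -scalerBr (@rpredZ _ _ S) //.
by apply/lquot_eq; rewrite (@reprK V lquot).
Qed.

Fact lquot_scaleA a b q :
  lquot_scale a (lquot_scale b q) = lquot_scale (a * b) q.
Proof. by elim/lquotW: q => x; rewrite !lquot_scale_pi scalerA. Qed.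

Fact lquot_scale1 : left_id 1 lquot_scale.
Proof. by elim/lquotW => x; rewrite lquot_scale_pi scale1r. Qed.

Fact lquot_scaleDr : right_distributive lquot_scale +%R.
Proof.
move=> a; elim/lquotW => x; elim/lquotW => y.
by rewrite -lquotD !lquot_scale_pi scalerDr lquotD.
Qed.

Fact lquot_scaleDl q : {morph lquot_scale^~ q : a b / a + b}.
Proof.
by elim/lquotW: q => x a b; rewrite !lquot_scale_pi scalerDl lquotD.
Qed.

HB.instance Definition _ := GRing.Zmodule_isLmodule.Build k lquot
  lquot_scaleA lquot_scale1 lquot_scaleDr lquot_scaleDl.

Lemma lquotZ a (x : V) : \pi_lquot (a *: x) = a *: \pi_lquot x.
Proof. by rewrite -lquot_scale_pi. Qed.

End LmodSubQuotient.

Definition is_basis (k : fieldType) (V : lmodType k) (n : nat)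
    (b : 'I_n -> V) : Prop :=
  (forall c : 'I_n -> k, \sum_i c i *: b i = 0 -> forall i, c i = 0) /\
  (forall v : V, exists c : 'I_n -> k, v = \sum_i c i *: b i).

Definition has_dim (k : fieldType) (V : lmodType k) (n : nat) : Prop :=
  exists b : 'I_n -> V, is_basis b.

Record opmodule (k : fieldType) (C : category) := OpModule {
  opm :> C -> lmodType k;
  act : forall X Y, hom X Y -> opm Y -> opm X;
  act_linear : forall X Y (f : hom X Y), linear (act f);
  act1 : forall X (v : opm X), act (idm X) v = v;
  actM : forall X Y Z (g : hom Y Z) (f : hom X Y) (v : opm Z),
    act (comp g f) v = act f (act g v)
}.
Arguments act {k C} o {X Y}.

HB.instance Definition _ (k : fieldType) (C : category) (M : opmodule k C)
    (X Y : C) (f : hom X Y) :=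
  GRing.isLinear.Build k (M Y) (M X) _ (act M f) (act_linear f).

Definition opm_iso (k : fieldType) (C : category) (M N : opmodule k C) : Prop :=
  exists phi : forall X, M X -> N X,
    [/\ forall X, linear (phi X),
        forall X, bijective (phi X)
      & forall X Y (f : hom X Y) (v : M Y),
          phi X (act M f v) = act N f (phi Y v)].

Section SubQuotient.
Variables (k : fieldType) (C : category) (M : opmodule k C).

Record submodule := SubModule {
  subm :> forall X, submodClosed (M X);
  subm_act : forall X Y (f : hom X Y) (v : M Y),
    v \in subm Y -> act M f v \in subm X
}.

Variable N : submodule.

Definition sub_act X Y (f : hom X Y) (v : lsub (N Y)) : lsub (N X) :=
  exist (fun v => is_true (v \in N X)) (act M f (val v))
    (subm_act f (valP v)).

Lemma sub_act_linear X Y (f : hom X Y) : linear (sub_act f).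
Proof. by move=> a u v; apply: val_inj; rewrite /= !linearP. Qed.

Lemma sub_act1 X (v : lsub (N X)) : sub_act (idm X) v = v.
Proof. by apply: val_inj; rewrite /= act1. Qed.

Lemma sub_actM X Y Z (g : hom Y Z) (f : hom X Y) (v : lsub (N Z)) :
  sub_act (comp g f) v = sub_act f (sub_act g v).
Proof. by apply: val_inj; rewrite /= actM. Qed.

Definition sub_opm : opmodule k C :=
  OpModule sub_act_linear sub_act1 sub_actM.

Definition quot_act X Y (f : hom X Y) (q : lquot (N Y)) : lquot (N X) :=
  \pi_(lquot (N X)) (act M f (repr q)).

Lemma quot_act_pi X Y (f : hom X Y) (v : M Y) :
  quot_act f (\pi_(lquot (N Y)) v) = \pi_(lquot (N X)) (act M f v).
Proof.
apply/lquot_eq; rewrite -linearB; apply: subm_act.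
by apply/lquot_eq; rewrite (@reprK _ (lquot (N Y))).
Qed.

Lemma quot_act_linear X Y (f : hom X Y) : linear (quot_act f).
Proof.
move=> a; elim/lquotW => u; elim/lquotW => v.
by rewrite -lquotZ -lquotD !quot_act_pi linearP lquotD lquotZ.
Qed.

Lemma quot_act1 X (q : lquot (N X)) : quot_act (idm X) q = q.
Proof. by elim/lquotW: q => v; rewrite quot_act_pi act1. Qed.

Lemma quot_actM X Y Z (g : hom Y Z) (f : hom X Y) (q : lquot (N Z)) :
  quot_act (comp g f) q = quot_act f (quot_act g q).
Proof. by elim/lquotW: q => v; rewrite !quot_act_pi actM. Qed.

Definition quot_opm : opmodule k C :=
  OpModule quot_act_linear quot_act1 quot_actM.

End SubQuotient.

Section SuccessiveQuotient.
Variables (k : fieldType) (C : category) (M : opmodule k C).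
Variables (A B : submodule M).

Definition inter_pred X : pred (lsub (A X)) := fun v => val v \in B X.

Lemma inter_closed X : subsemimod_closed (@inter_pred X).
Proof.
split; first split.
- by rewrite unfold_in /inter_pred raddf0 rpred0.
- by move=> u v uB vB; rewrite unfold_in /inter_pred raddfD; apply: rpredD.
- by move=> a v vB; rewrite unfold_in /inter_pred linearZ; apply: rpredZ.
Qed.

HB.instance Definition _ X :=
  GRing.isSubmodClosed.Build k (lsub (A X)) (@inter_pred X) (@inter_closed X).

Definition inter_submod X : submodClosed (lsub (A X)) :=
  GRing.SubmodClosed.clone k (lsub (A X)) (@inter_pred X) _.

Lemma inter_act X Y (f : hom X Y) (v : sub_opm A Y) :
  v \in @inter_pred Y -> act (sub_opm A) f v \in @inter_pred X.
Proof. exact: subm_act. Qed.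

Definition inter_subm : submodule (sub_opm A) :=
  @SubModule k C (sub_opm A)
    (fun X => inter_submod X) inter_act.

(* A / (A :&: B), that is, A / B when B is contained in A. *)
Definition succ_quot : opmodule k C := quot_opm inter_subm.

End SuccessiveQuotient.

Section DirectSum.
Variables (k : fieldType) (C : category).

Definition zero_opm : opmodule k C :=
  @OpModule k C (fun _ => 'rV[k]_0) (fun _ _ _ => id)
    (fun _ _ _ _ _ _ => erefl) (fun _ _ => erefl) (fun _ _ _ _ _ _ => erefl).

Section Binary.
Variables M N : opmodule k C.

Definition sum_act X Y (f : hom X Y) (v : M Y * N Y) : M X * N X :=
  (act M f v.1, act N f v.2).

Lemma sum_act_linear X Y (f : hom X Y) : linear (sum_act f).
Proof. by move=> a u v; rewrite /sum_act /= !linearP. Qed.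

Lemma sum_act1 X (v : M X * N X) : sum_act (idm X) v = v.
Proof. by case: v => u v; rewrite /sum_act !act1. Qed.

Lemma sum_actM X Y Z (g : hom Y Z) (f : hom X Y) (v : M Z * N Z) :
  sum_act (comp g f) v = sum_act f (sum_act g v).
Proof. by rewrite /sum_act !actM. Qed.

Definition sum_opm : opmodule k C :=
  @OpModule k C (fun X => (M X * N X)%type) sum_act
    sum_act_linear sum_act1 sum_actM.

End Binary.

Definition direct_sum (s : seq (opmodule k C)) : opmodule k C :=
  foldr sum_opm zero_opm s.

End DirectSum.

Section Principal.
Variables (k : fieldType) (C : category) (S : C).

(* The free k-module on the finite set hom X S is the module of functions     *)
(* from hom X S to k; the basis vector of index g is the indicator function   *)
(* of g, and it is sent by f : hom X Y to the basis vector of index g \o f.   *)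
Definition principal_act X Y (f : hom X Y) (v : {ffun hom Y S -> k^o}) :
    {ffun hom X S -> k^o} :=
  [ffun h => \sum_(g : hom Y S | comp g f == h) v g].

Lemma principal_act_linear X Y (f : hom X Y) : linear (principal_act f).
Proof.
move=> a u v; apply/ffunP => h; rewrite !ffunE scaler_sumr -big_split /=.
by apply: eq_bigr => g _; rewrite !ffunE.
Qed.

Lemma principal_act1 X (v : {ffun hom X S -> k^o}) :
  principal_act (idm X) v = v.
Proof.
apply/ffunP => h; rewrite ffunE (eq_bigl (pred1 h)) ?big_pred1_eq //.
by move=> g; rewrite compm1.
Qed.

Lemma principal_actM X Y Z (g : hom Y Z) (f : hom X Y)
    (v : {ffun hom Z S -> k^o}) :
  principal_act (comp g f) v = principal_act f (principal_act g v).
Proof.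
apply/ffunP => h; rewrite !ffunE.
rewrite (partition_big (fun e => comp e g) (fun e => comp e f == h)) /=; last first.
  by move=> e; rewrite compA.
apply: eq_bigr => e eh; rewrite ffunE; apply: eq_bigl => e'; rewrite compA.
by case: (comp e' g =P e) => [->|]; rewrite ?eh ?andbF.
Qed.

Definition principal : opmodule k C :=
  @OpModule k C (fun X => {ffun hom X S -> k^o}) principal_act
    principal_act_linear principal_act1 principal_actM.

End Principal.

Section Small.
Variables (k : fieldType) (C : category) (d : nat).

Definition generated_in_degree (M : opmodule k C) : Prop :=
  exists s : seq C, all (fun X => osize X <= d)%N s /\
  exists N : submodule (direct_sum [seq principal k X | X <- s]),
    opm_iso M (quot_opm N).

Definition small (M : opmodule k C) : Prop :=
  exists N : opmodule k C, generated_in_degree N /\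
  exists (A : submodule N) (B : submodule (sub_opm A)),
    opm_iso M (quot_opm B).

Definition is_filtration (M : opmodule k C) (n : nat)
    (F : nat -> submodule M) : Prop :=
  [/\ forall X (v : M X), v \in F 0%N X -> v = 0,
      forall i, (i < n)%N -> forall X, {subset F i X <= F i.+1 X}
    & forall X (v : M X), v \in F n X].

Definition graded (M : opmodule k C) (n : nat) (F : nat -> submodule M) :
    opmodule k C :=
  direct_sum [seq succ_quot (F i.+1) (F i) | i <- iota 0 n].

Definition smallish (M : opmodule k C) : Prop :=
  exists (n : nat) (F : nat -> submodule M),
    is_filtration n F /\ small (graded n F).

End Small.

(* Main.v *)
Require Import Defs.
From HB Require Import structures.
From mathcomp Require Import all_boot all_order all_algebra.
From Stdlib Require Import Classical.

(** A contraction [f : S -> T] of trees is determined by the edges of [S]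
    that it does not collapse: over every edge [uv] of [T] lies an edge [ab] of [S] with
    [f a = u] and [f b = v], and two contractions that share such a lift for
    every edge are equal ([contraction_eq]).  A fixed [T] has boundedly many
    edges, and each of them has at most polynomially many possible lifts in
    [S]; so the number of morphisms from [S] to [T] is bounded by a polynomial
    in the number of edges of [S] ([card_contraction_leq]).  Contractions that
    preserve a root are in particular contractions, and [few_leaves_cat l] is a
    full subcategory of [tree_cat], so this bound holds in all three
    categories.

    The rest holds for modules over any category whose hom sets into a fixed
    object grow polynomially.  The value at [X] of the principal projective of
    [S] has dimension [#|hom X S|]; hence a finite sum of principal projectives
    has polynomial growth.  Passing to subquotients can only lower dimensions,
    and a filtration with [r] steps whose graded pieces all have dimension at
    most [n] gives a module of dimension at most [r * n]
    ([smallish_dim_le]), where [r] does not depend on [X].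

    Dimensions are handled through the predicate [dim_le V n], that [V] has a
    spanning family of at most [n] vectors, which passes to quotients and
    extensions at once.  It passes to subspaces, and provides the final basis,
    because independent families are no longer than spanning ones
    ([indep_leq]). *)

Set Implicit Arguments.
Unset Strict Implicit.
Unset Printing Implicit Defensive.

Import Order.TTheory GRing.Theory Num.Theory.
Local Open Scope ring_scope.
Local Open Scope quotient_scope.

(** * Bounds on the dimension of a vector space *)

Section Dimension.
Variable k : fieldType.
Implicit Types U V W : lmodType k.

Definition spans V n (b : 'I_n -> V) : Prop :=
  forall v, exists c : 'I_n -> k, v = \sum_i c i *: b i.

Definition indep V n (b : 'I_n -> V) : Prop :=
  forall c : 'I_n -> k, \sum_i c i *: b i = 0 -> forall i, c i = 0.

Definition dim_le V n : Prop :=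
  exists2 m, (m <= n)%N & exists b : 'I_m -> V, spans b.

Lemma linear_comb V W (f : V -> W) n (c : 'I_n -> k) (b : 'I_n -> V) :
  linear f -> f (\sum_i c i *: b i) = \sum_i c i *: f (b i).
Proof.
move=> flin; pose f' : {linear V -> W} :=
  HB.pack f (GRing.isLinear.Build k V W _ f flin).
rewrite -[f]/(f' : V -> W) linear_sum.
by apply: eq_bigr => i _; rewrite linearZ.
Qed.

Lemma linearB_prop V W (f : V -> W) : linear f -> {morph f : u v / u - v}.
Proof.
move=> flin; pose f' : {linear V -> W} :=
  HB.pack f (GRing.isLinear.Build k V W _ f flin).
exact: (raddfB f').
Qed.

(** The coefficients of the [m] vectors [f (b i)] over [n] spanning vectors form
    an [m] by [n] matrix; for [n < m] its rows satisfy a nontrivial relation,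
    which injectivity of [f] turns into a relation between the [b i]. *)
Lemma indep_leq U V (f : U -> V) m n (b : 'I_m -> U) (s : 'I_n -> V) :
  linear f -> injective f -> indep b -> spans s -> (m <= n)%N.
Proof.
move=> flin finj bI sS; rewrite leqNgt; apply/negP => nm.
have [c cE] := fin_all_exists (fun i => sS (f (b i))).
pose A : 'M[k]_(m, n) := \matrix_(i, j) c i j.
have : kermx A != 0.
  rewrite kermx_eq0 /row_free neq_ltn.
  by rewrite (leq_ltn_trans (rank_leq_col A) nm).
case/rowV0Pn => u /sub_kermxP uA /negP[]; apply/eqP/rowP => i.
rewrite mxE; apply: bI i; apply: finj.
have f0 : f 0 = 0 by rewrite -(subrr 0) linearB_prop // subrr.
rewrite linear_comb // f0.
under eq_bigr => i _ do rewrite cE scaler_sumr.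
rewrite exchange_big big1 // => j _ /=.
under eq_bigr => i _ do rewrite scalerA.
rewrite -scaler_suml; have /rowP/(_ j) := uA; rewrite !mxE.
under eq_bigr => i _ do rewrite mxE.
by move=> ->; rewrite scale0r.
Qed.

Lemma indep_extend U m (b : 'I_m -> U) v :
    indep b -> (forall c : 'I_m -> k, v <> \sum_i c i *: b i) ->
  indep (fun i : 'I_m.+1 => oapp b v (unlift ord0 i)).
Proof.
move=> bI vN c; rewrite big_ord_recl unlift_none /=.
under eq_bigr => i _ do rewrite liftK /=.
have [c0|c0] := eqVneq (c ord0) 0.
  rewrite c0 scale0r add0r => /bI cE i.
  by case: (unliftP ord0 i) => [j ->|->].
move=> /eqP; rewrite addr_eq0 => /eqP vE.
case: (vN (fun i => - (c ord0)^-1 * c (lift ord0 i))).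
under eq_bigr => i _ do rewrite -scalerA.
by rewrite -scaler_sumr scaleNr -scalerN -vE scalerA mulVf // scale1r.
Qed.

(** An independent family that does not span is extended by a vector outside
    its span, and the bound stops the process.  Excluded middle is used to
    decide whether a family spans. *)
Lemma indep_basis U n :
    (forall m (b : 'I_m -> U), indep b -> (m <= n)%N) ->
  exists2 m, (m <= n)%N & has_dim U m.
Proof.
move=> bound.
(* [r] bounds the number of vectors that can still be added. *)
suff ext r m (b : 'I_m -> U) : (n - m <= r)%N -> indep b ->
    exists2 m, (m <= n)%N & has_dim U m.
  have b0 : indep (fun _ : 'I_0 => 0 : U) by move=> c _ [].
  exact: ext (leqnn _) b0.
elim: r m b => [|r IH] m b nmr bI;
  (have [bS|/not_all_ex_not[v vN]] := classic (spans b);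
   first by exists m; [exact: bound bI | exists b]);
  have bI' := indep_extend bI (not_ex_all_not _ _ vN);
  have mn := bound _ _ bI'.
- by move: nmr; rewrite leqn0 subn_eq0 leqNgt mn.
- by apply: IH bI'; rewrite -ltnS; apply: leq_trans nmr; rewrite ltn_sub2l.
Qed.

(** Spanning families do not restrict to a subspace, but bounds on the length of
    independent families do; this is the passage between the two. *)
Lemma dim_le_inj_has_dim U V (f : U -> V) n :
  linear f -> injective f -> dim_le V n -> exists2 m, (m <= n)%N & has_dim U m.
Proof.
move=> flin finj [p pn [s sS]]; apply: indep_basis => m b bI.
exact: leq_trans (indep_leq flin finj bI sS) pn.
Qed.

Lemma dim_le_has_dim V n : dim_le V n -> exists2 m, (m <= n)%N & has_dim V m.
Proof. by apply: (@dim_le_inj_has_dim V V id). Qed.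

Lemma dim_le_inj U V (f : U -> V) n :
  linear f -> injective f -> dim_le V n -> dim_le U n.
Proof.
move=> flin finj /(dim_le_inj_has_dim flin finj)[m mn [b [_ bS]]].
by exists m => //; exists b.
Qed.

Lemma dim_le_surj V W (f : V -> W) n :
  linear f -> (forall w, exists v, f v = w) -> dim_le V n -> dim_le W n.
Proof.
move=> flin fsurj [m mn [b bS]]; exists m => //; exists (f \o b) => w.
have [v <-] := fsurj w; have [c ->] := bS v.
by exists c; rewrite linear_comb.
Qed.

(** The image of a spanning family of [U] and lifts of a spanning family of [W]
    together span [V]. *)
Lemma dim_le_ext U V W (g : U -> V) (f : V -> W) m n :
    linear g -> linear f -> (forall w, exists v, f v = w) ->
    (forall v, f v = 0 -> exists u, g u = v) ->
  dim_le U m -> dim_le W n -> dim_le V (m + n).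
Proof.
move=> glin flin fsurj kerf [p pm [s sS]] [q qn [t tS]].
have [t' t'E] := fin_all_exists (fun j => fsurj (t j)).
exists (p + q)%N; first exact: leq_add.
exists (fun i => match split i with inl j => g (s j) | inr j => t' j end) => v.
have [d dE] := tS (f v).
have [|u uE] := kerf (v - \sum_j d j *: t' j).
  rewrite linearB_prop // linear_comb // dE.
  by under [X in _ - X]eq_bigr => j _ do rewrite t'E; rewrite subrr.
have [c cE] := sS u.
exists (fun i => match split i with inl j => c j | inr j => d j end).
rewrite big_split_ord /=.
under eq_bigr => i _ do rewrite (unsplitK (inl i)).
under [X in _ + X]eq_bigr => i _ do rewrite (unsplitK (inr i)).
by rewrite -linear_comb // -cE uE subrK.
Qed.

Lemma dim_le0 V : (forall v : V, v = 0) -> dim_le V 0.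
Proof.
move=> V0; exists 0%N => //; exists (fun _ => 0) => v.
by exists (fun _ => 0); rewrite big_ord0.
Qed.

Lemma dim_le_prod V W m n :
  dim_le V m -> dim_le W n -> dim_le (V * W)%type (m + n).
Proof.
apply: (@dim_le_ext V (V * W)%type W (fun v => (v, 0)) snd) => //.
- by move=> a u v; congr pair; rewrite /= scaler0 addr0.
- by move=> w; exists (0, w).
- by case=> v w /= ->; exists v.
Qed.

Lemma dim_le_ffun (I : finType) : dim_le {ffun I -> k^o} #|I|.
Proof.
exists #|I| => //; exists (fun i => [ffun x => (x == enum_val i)%:R]) => v.
exists (fun i => v (enum_val i)); apply/ffunP => x.
rewrite sum_ffunE (bigD1 (enum_rank x)) //= !ffunE enum_rankK eqxx.
rewrite big1 => [|i]; first by rewrite addr0 /GRing.scale /= mulr1.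
rewrite -(inj_eq enum_val_inj) enum_rankK eq_sym => /negPf xi.
by rewrite !ffunE xi scaler0.
Qed.

End Dimension.

(** * Dimension of the values of a smallish module *)

Section SubquotientDimension.
Variables (k : fieldType) (C : category).
Implicit Types M N : opmodule k C.

Lemma dim_le_iso M N (X : C) n :
  opm_iso M N -> dim_le (N X) n -> dim_le (M X) n.
Proof.
case=> phi [phil phib _]; apply: (dim_le_inj (phil X)).
exact: bij_inj (phib X).
Qed.

Lemma dim_le_quot M (N : submodule M) (X : C) n :
  dim_le (M X) n -> dim_le (quot_opm N X) n.
Proof.
apply: (@dim_le_surj _ _ _ (fun v => \pi_(lquot (N X)) v)).
- by move=> a u v; rewrite lquotD lquotZ.
- by elim/lquotW => v; exists v.
Qed.

Lemma dim_le_sub M (N : submodule M) (X : C) n :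
  dim_le (M X) n -> dim_le (sub_opm N X) n.
Proof.
apply: (@dim_le_inj _ (lsub (N X)) _ val); last exact: val_inj.
by move=> a u v; rewrite linearP.
Qed.

Lemma dim_le_direct_sum (s : seq C) (X : C) :
  dim_le (direct_sum [seq principal k Y | Y <- s] X)
         (\sum_(Y <- s) #|Defs.hom X Y|).
Proof.
elim: s => [|Y s IH]; rewrite /= ?big_nil ?big_cons.
  by apply: dim_le0 => v; apply/rowP => -[].
exact: dim_le_prod (dim_le_ffun _ _) IH.
Qed.

Lemma dim_le_summand (s : seq nat) (G : nat -> opmodule k C) (X : C) i n :
    i \in s -> dim_le (direct_sum [seq G j | j <- s] X) n ->
  dim_le (G i X) n.
Proof.
elim: s => [//|j s IH]; rewrite inE => ijs dimS.
have fstS : dim_le (G j X) n.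
  by move: dimS; apply: (@dim_le_surj _ _ _ fst) => // v; exists (v, 0).
have sndS : dim_le (direct_sum [seq G j | j <- s] X) n.
  by move: dimS; apply: (@dim_le_surj _ _ _ snd) => // v; exists (0, v).
by case/orP: ijs => [/eqP->|/IH]; [|apply].
Qed.

(** Each graded piece is a summand of [graded r F], so of dimension at most [n],
    and climbing the filtration adds one piece at each of the [r] steps.  Counting
    the pieces jointly would give the bound [n], but any bound that is linear in
    [n] with a factor independent of [X] serves the purpose. *)
Lemma dim_le_filtration M r (F : nat -> submodule M) (X : C) n :
    is_filtration r F -> dim_le (graded r F X) n ->
  dim_le (M X) (r * n).
Proof.
case=> F0 FS Fr dimG.
suff dimF i : (i <= r)%N -> dim_le (lsub (F i X)) (i * n).
  move: (dimF r (leqnn r)); apply: (@dim_le_surj _ _ _ val).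
  - by move=> a u v; rewrite linearP.
  - by move=> v; exists (Sub v (Fr X v)).
elim: i => [|i IH] ir.
  by apply: dim_le0 => v; apply: val_inj; apply: F0 (valP v).
rewrite mulSnr.
have dimQ : dim_le (succ_quot (F i.+1) (F i) X) n.
  by move: dimG; apply: dim_le_summand; rewrite mem_iota.
move: (IH (ltnW ir)) dimQ.
apply: (@dim_le_ext _ (lsub (F i X)) (lsub (F i.+1 X)) _
  (fun v => Sub (val v) (FS i ir X _ (valP v)))
  (fun v => \pi_(lquot (inter_subm (F i.+1) (F i) X)) v)).
- by move=> a u v; apply: val_inj.
- by move=> a u v; rewrite lquotD lquotZ.
- by elim/lquotW => v; exists v.
move=> v v0.
have vF : val v \in F i X.
  have /lquot_eq : \pi_(lquot (inter_subm (F i.+1) (F i) X)) v = \pi 0.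
    by rewrite v0 -[X in \pi X](scale0r 0) lquotZ scale0r.
  by rewrite subr0.
by exists (Sub (val v) vF); apply: val_inj.
Qed.

Lemma smallish_dim_le d M : smallish d M ->
  exists r (s : seq C), forall X, dim_le (M X) (r * \sum_(S <- s) #|Defs.hom X S|).
Proof.
case=> r [F [Ffilt [N [[s [_ [R isoN]]] [A [B isoG]]]]]].
exists r, s => X; apply: dim_le_filtration Ffilt _.
apply: (dim_le_iso isoG); apply: dim_le_quot; apply: dim_le_sub.
apply: (dim_le_iso isoN); apply: dim_le_quot; exact: dim_le_direct_sum.
Qed.

End SubquotientDimension.

(** * Polynomial growth *)

Section PolynomialBounds.
Variable C : category.
Implicit Types h : C -> nat.

(** Bounding polynomials are nonnegative at every size that occurs, as they bound
    natural numbers; this is what makes products of bounds valid. *)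
Definition poly_bounded h : Prop :=
  exists f : {poly rat}, forall X, (h X)%:R <= f.[(osize X)%:R].

Lemma poly_bounded_leq h h' :
  (forall X, h X <= h' X)%N -> poly_bounded h' -> poly_bounded h.
Proof.
move=> hh' [f fP]; exists f => X; apply: le_trans (fP X).
by rewrite ler_nat.
Qed.

Lemma poly_bounded_const n : poly_bounded (fun _ => n).
Proof. by exists n%:R%:P => X; rewrite hornerC. Qed.

Lemma poly_bounded_size : poly_bounded osize.
Proof. by exists 'X => X; rewrite hornerX. Qed.

Lemma poly_boundedD h h' : poly_bounded h -> poly_bounded h' ->
  poly_bounded (fun X => h X + h' X)%N.
Proof.
move=> [f fP] [g gP]; exists (f + g) => X.
by rewrite hornerD natrD lerD.
Qed.

Lemma poly_boundedM h h' : poly_bounded h -> poly_bounded h' ->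
  poly_bounded (fun X => h X * h' X)%N.
Proof.
move=> [f fP] [g gP]; exists (f * g) => X.
by rewrite hornerM natrM ler_pM.
Qed.

Lemma poly_boundedX h n : poly_bounded h -> poly_bounded (fun X => h X ^ n)%N.
Proof.
move=> hP; elim: n => [|n IH]; first exact: poly_bounded_const.
apply: poly_bounded_leq (poly_boundedM hP IH) => X.
by rewrite expnS.
Qed.

Lemma poly_bounded_sum (I : Type) (s : seq I) (H : I -> C -> nat) :
  (forall i, poly_bounded (H i)) ->
  poly_bounded (fun X => \sum_(i <- s) H i X)%N.
Proof.
move=> HP; elim: s => [|i s IH].
  by apply: poly_bounded_leq (poly_bounded_const 0) => X; rewrite big_nil.
apply: poly_bounded_leq (poly_boundedD (HP i) IH) => X.
by rewrite big_cons.
Qed.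

Lemma smallish_poly_bounded (k : fieldType) d (M : opmodule k C) :
    (forall S, poly_bounded (fun X => #|Defs.hom X S|)) -> smallish d M ->
  exists f : {poly rat}, forall X : C,
    exists n : nat, has_dim (M X) n /\ n%:R <= f.[(osize X)%:R].
Proof.
move=> homP /smallish_dim_le[r [s dimM]].
have [f fP] := poly_boundedM (poly_bounded_const r) (poly_bounded_sum s homP).
exists f => X; have [n nle nM] := dim_le_has_dim (dimM X).
exists n; split=> //; apply: le_trans (fP X).
by rewrite ler_nat.
Qed.

End PolynomialBounds.

(** * Counting contractions onto a fixed tree *)

Section Contractions.
Local Open Scope nat_scope.

(** If every vertex has a neighbour, the vertices are covered by the edges, which
    have two elements each; otherwise connectedness leaves a single vertex.  The
    sharp value is [nb_edges T + 1], but the growth is all that matters. *)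
Lemma card_vertex_leq (T : tree) : #|T| <= (nb_edges T).*2.+1.
Proof.
have [/forallP nbr|/forallPn[x /existsPn xN]] :=
  boolP [forall x : T, exists y, adj x y].
  have /subset_leq_card : [set: T] \subset cover (edges T).
    apply/subsetP => x _; have /existsP[y xy] := nbr x.
    apply/bigcupP; exists [set x; y]; last by rewrite !inE eqxx.
    by apply/imsetP; exists (x, y); rewrite ?inE.
  rewrite cardsT => /leq_trans -> //; apply: leq_trans (leq_card_cover _) _.
  apply: leqW; rewrite -muln2 -sum_nat_const; apply: leq_sum => e.
  by case/imsetP => -[u v] _ -> /=; rewrite cards2; case: eqP.
suff /subset_leq_card : T \subset [set x] by rewrite cards1 => /leq_trans->.
apply/subsetP => y _; rewrite inE; have /connectP[[|z p] /=] :=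
  tree_connected x y; first by move=> _ ->.
by rewrite (negPf (xN z)).
Qed.

Lemma subtree_of_path (T : tree) (w : T) p :
  path adj w p -> is_subtree [set z in w :: p].
Proof.
move=> wp; set A := [set z in w :: p].
have wA : w \in A by rewrite !inE eqxx.
have wp' : path (induced A) w p.
  apply: (sub_in_path (P := [in A])) wp => [y z yA zA yz|].
    by apply/and3P.
  by apply/allP => z zp; rewrite /= inE.
have con z : z \in A -> connect (induced A) w z.
  by rewrite inE; apply: (path_connect wp').
have sym : connect_sym (induced A).
  by apply: sym_connect_sym => y z; rewrite /induced /= adj_sym
    [(y \in A) && _]andbC.
apply/is_subtreeP; split; first by exists w.
move=> y z yA zA; apply: connect_trans (con z zA); rewrite sym; exact: con.
Qed.

(** Suppose [f x <> g x], and let [uw] be the first edge of the path in [T] from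
    [u = f x] to [g x], with common lift [ab].  The fibre of [f] over [u] is
    connected and contains [a] and [x] but not [b]; the preimage under [g] of
    the rest of the path is connected and contains [x] and [b] but not [a].  So
    [a] and [b] are joined in [S] without the edge [ab], which is impossible in
    a tree. *)
Lemma contraction_eq (S T : tree) (f g : {ffun S -> T}) :
    is_contraction f -> is_contraction g ->
    (forall u v, adj u v -> exists a b,
      [/\ adj a b, f a = u, f b = v, g a = u & g b = v]) ->
  f = g.
Proof.
move=> fC gC lift; apply/ffunP => x; apply/eqP.
apply: contraT => /eqP fgx.
have /connectP[p0 p0a vE] := tree_connected (f x) (g x).
case/shortenP: p0a vE => -[|w p] /= pa up _ vE; first by case: fgx.
case/andP: pa => uw wp; case/andP: up => uwp _ {p0}.
have [a [b [ab fa fb ga gb]]] := lift _ _ uw.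
have /is_subtreeP[_ conf] := proj2 (is_contractionP _ fC) (f x).
have /is_subtreeP[_ cong] :=
  contraction_preim_subtree gC (subtree_of_path wp).
have xf : connect (induced [set y | f y == f x]) a x.
  by apply: conf; rewrite inE ?fa.
have xg : connect (induced [set y | g y \in [set z in w :: p]]) x b.
  by apply: cong; rewrite !inE ?gb ?eqxx // vE -in_cons mem_last.
case/negP: (tree_bridge ab); apply: (@connect_trans _ _ x).
  apply: connect_sub xf => y z /and3P[yz _]; rewrite inE => zf.
  apply: connect1; rewrite /= yz /=; apply/negP => /andP[_ /eqP zb].
  by move: zf uwp; rewrite zb fb inE => /eqP->; rewrite eqxx.
apply: connect_sub xg => y z /and3P[yz]; rewrite !inE => yg _.
apply: connect1; rewrite /= yz /=; apply/negP => /andP[/eqP ya _].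
by move: yg uwp; rewrite ya ga inE => ->.
Qed.

(** The lifts are indexed by all pairs of vertices of [T], so that the codomain is
    a plain finite function type; pairs that are not adjacent may have no lift,
    whence the option type. *)
Definition edge_lifts (S T : tree) (f : contraction S T) :
    {ffun T * T -> option (S * S)} :=
  [ffun e => [pick p : S * S |
    [&& adj p.1 p.2, val f p.1 == e.1 & val f p.2 == e.2]]].

Lemma edge_lifts_inj (S T : tree) : injective (@edge_lifts S T).
Proof.
move=> f g /ffunP fg; apply: val_inj.
apply: contraction_eq (valP f) (valP g) _ => u v uv.
move: (fg (u, v)); rewrite !ffunE /=.
case: pickP => [[a b] /and3P[ab /eqP fa /eqP fb]|nf]; last first.
  have [a [b [ab fa fb]]] := contraction_lift_edge (valP f) uv.
  by move: (nf (a, b)); rewrite /= ab fa fb !eqxx.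
case: pickP => // -[a' b'] /and3P[_ /eqP ga /eqP gb] [? ?]; subst a' b'.
by exists a, b.
Qed.

Lemma card_contraction_leq (S T : tree) :
  #|contraction S T| <= ((nb_edges S).*2.+1 ^ 2).+1 ^ (#|T| ^ 2).
Proof.
apply: leq_trans (leq_card _ (@edge_lifts_inj S T)) _.
rewrite card_ffun card_option !card_prod !mulnn.
(* [leq_exp2r] needs a positive exponent. *)
have [->|T0] := posnP (#|T| ^ 2); first by [].
by rewrite leq_exp2r // ltnS leq_exp2r // card_vertex_leq.
Qed.

End Contractions.

Lemma contraction_poly_bounded (T : tree) :
  @poly_bounded tree_cat (fun S => #|contraction S T|).
Proof.
apply: (poly_bounded_leq (C := tree_cat) (card_contraction_leq^~ T)).
pose one := poly_bounded_const tree_cat 1.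
pose size := poly_bounded_size tree_cat.
have V := poly_boundedX 2 (poly_boundedD one (poly_boundedD size size)).
apply: poly_bounded_leq (poly_boundedX (#|T| ^ 2) (poly_boundedD one V)) => S.
by rewrite addnn !add1n.
Qed.

(** * The three categories of trees *)

Theorem theorem1p3 (k : fieldType) (d : nat) (D : category)
    (hD : [\/ D = tree_cat, D = rooted_tree_cat
            | exists2 l : nat, (2 <= l)%N & D = few_leaves_cat l])
    (M : opmodule k D) (hM : smallish d M) :
  exists f : {poly rat}, forall T : D,
    exists n : nat, has_dim (M T) n /\ (n%:R <= f.[(osize T)%:R])%R.
Proof.
apply: smallish_poly_bounded hM => {M} S.
case: hD S => [->|->|[l _ ->]] S.
- exact: contraction_poly_bounded.
- have [f fP] := contraction_poly_bounded S; exists f => T.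
  apply: le_trans (fP (rtree T)); rewrite ler_nat.
  exact: (leq_card (val : rcontraction T S -> contraction T S) val_inj).
- have [f fP] := contraction_poly_bounded (sval S); exists f => T.
  exact: fP (sval T).
Qed.
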